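(* Let $P_m,Q_m,R_m$ be the polynomials (depending on $D\in\mathbb{C}$) defined in the context. Consider the psi series $$x(t)=\sum_{m=-1}^{\infty}P_m(\eta+C)(t-t_0)^m,\quad y(t)=\sum_{m=-2}^{\infty}Q_m(\eta+C)(t-t_0)^m,\quad z(t)=\sum_{m=-2}^{\infty}R_m(\eta+C)(t-t_0)^m .$$ (i) These psi series formally satisfy the Lorenz system $$\frac{dx}{dt}=10(y-x),\qquad \frac{dy}{dt}=28x-y-xz,\qquad \frac{dz}{dt}=-\tfrac{8}{3}z+xy .$$ The location $t_0\in\mathbb{C}$ of the singularity is arbitrary, and the two constants $C,D\in\mathbb{C}$ occurring in the psi series are undetermined (arbitrary). The constant $C$ and $\eta$ occur only in the group $(\eta+C)$. (ii) Another formal solution is obtained by flipping the signs of all the $P_m$ and all the $Q_m$ while leaving the $R_m$ unchanged. (iii) For the solution to be formally valid, $\eta$ can be defined as $\log(b(t-t_0))$ for any complex number $b$ with $|b|=1$.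
   Context: Formal satisfaction: series of the form $\sum_{m\ge -N}p_m(\eta)(t-t_0)^m$ with polynomial coefficients $p_m$ are added and multiplied as formal Laurent series in $(t-t_0)$ with coefficients polynomial in $\eta$, and are differentiated termwise using $d\eta/dt=1/(t-t_0)$, i.e. $\frac{d}{dt}\left[p(\eta)(t-t_0)^m\right]=(p'(\eta)+mp(\eta))(t-t_0)^{m-1}$. The system is formally satisfied if the coefficients (polynomials in $\eta$) of each power of $(t-t_0)$ on both sides of each equation agree. Fix $D\in\mathbb{C}$. Polynomials $P_m$ ($m\ge -1$), $Q_m$, $R_m$ ($m\ge -2$) in one variable $u$ (to be evaluated at $u=\eta+C$) are defined as follows. Initial values: $Q_{-2}=-\frac{i}{5}$, $R_{-2}=-\frac15$; $P_{-1}=2i$, $Q_{-1}=2i$, $R_{-1}=\frac{17}{9}$; $P_0=\frac{71}{9}i$, $Q_0=-\frac{349}{81}i-\frac{988}{81}iu$, $R_0=\frac{1385}{54}-\frac{988}{81}u$; $P_1=-\frac{9880}{81}iu$, $Q_1=-\frac{25991}{108}i+\frac{64220}{243}iu$, $R_1=-\frac{211189}{972}+\frac{167960}{729}u$; $P_2=-\frac{2108195}{972}i+\frac{469300}{243}iu$, $Q_2=\frac{3}{10}iD-\frac{477319147}{131220}i-\frac{167831753}{65610}iu-\frac{273676}{2187}iu^2$, $R_2=-\frac15D+\frac{138959125}{17496}-\frac{58846039}{32805}u-\frac{1444456}{2187}u^2$; $P_3=iD-\frac{96356411}{6561}iu-\frac{2736760}{6561}iu^2$. For $m\ge 3$, the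 triple $X_m=(P_{m+1},Q_m,R_m)^T$ is defined recursively by $$X_m=-\sum_{j=0}^{\lfloor (m+2)/2\rfloor}A_m^{-j-1}\frac{d^jF_m}{du^j},$$ where $$A_m=\begin{pmatrix}-m-1&10&0\\ \frac15&-m&-2i\\ -\frac i5&2i&-m\end{pmatrix},\qquad F_m=\begin{pmatrix}-10P_m\\ 28P_{m-1}-Q_{m-1}-\sum_{j=0}^mP_jR_{m-j-1}\\ -\frac83R_{m-1}+\sum_{j=0}^mP_jQ_{m-j-1}\end{pmatrix}.$$ ($A_m$ has eigenvalues $-m+2,-m,-m-3$, so it is invertible for $m\ge3$.) *)

(* Defs.v *)
From HB Require Import structures.
From mathcomp Require Import all_boot all_order all_algebra zify ring lra.
From mathcomp Require Import all_classical all_reals all_analysis.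
From mathcomp Require Import complex.

Set Implicit Arguments.
Unset Strict Implicit.
Unset Printing Implicit Defensive.

Import Order.TTheory GRing.Theory Num.Theory.
Import numFieldNormedType.Exports.

Local Open Scope classical_set_scope.
Local Open Scope ring_scope.

(* Formal series \sum_(m >= -N) p_m(eta) (t - t0)^m.  Both eta and t - t0 are
   formal: the coefficient [f m] is a polynomial in the indeterminate 'X = eta,
   and the point t0 plays no role until the series is realized by functions
   (see ll_term). *)
Record log_laurent (K : comNzRingType) := LogLaurent {
  ll_coef :> int -> {poly K};
  ll_ord : nat;
  ll_coef_lt : forall m : int, m < - ll_ord%:Z -> ll_coef m = 0 }.

Section FormalOperations.
Variable K : comNzRingType.
Implicit Types f g : log_laurent K.

Fact ll_add_lt f g (m : int) :
  m < - (maxn (ll_ord f) (ll_ord g))%:Z -> f m + g m = 0.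
Proof. by move=> lt_m; rewrite !ll_coef_lt ?addr0 //; lia. Qed.
Definition ll_add f g : log_laurent K := LogLaurent (@ll_add_lt f g).

Fact ll_scale_lt (a : K) f (m : int) : m < - (ll_ord f)%:Z -> a *: f m = 0.
Proof. by move=> lt_m; rewrite ll_coef_lt // scaler0. Qed.
Definition ll_scale a f : log_laurent K := LogLaurent (@ll_scale_lt a f).

Fact ll_opp_lt f (m : int) : m < - (ll_ord f)%:Z -> - f m = 0.
Proof. by move=> lt_m; rewrite ll_coef_lt // oppr0. Qed.
Definition ll_opp f : log_laurent K := LogLaurent (@ll_opp_lt f).

Definition ll_sub f g : log_laurent K := ll_add f (ll_opp g).

(* Cauchy product \sum_i f i * g (m - i): only the indices i between
   - ll_ord f and m + ll_ord g can contribute. *)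
Definition ll_mul_coef f g (m : int) : {poly K} :=
  \sum_(k < (absz (m + (ll_ord f)%:Z + (ll_ord g)%:Z)).+1)
     f (k%:Z - (ll_ord f)%:Z) * g (m - (k%:Z - (ll_ord f)%:Z)).

Fact ll_mul_lt f g (m : int) :
  m < - (ll_ord f + ll_ord g)%:Z -> ll_mul_coef f g m = 0.
Proof.
move=> lt_m; apply: big1 => k _; rewrite [g _]ll_coef_lt ?mulr0 //; lia.
Qed.
Definition ll_mul f g : log_laurent K := LogLaurent (@ll_mul_lt f g).

(* d/dt [p(eta) (t - t0)^m] = (p'(eta) + m p(eta)) (t - t0)^(m - 1), from
   d eta/dt = 1/(t - t0). *)
Definition dterm (p : {poly K}) (m : int) : {poly K} := p^`() + m%:~R *: p.

Fact ll_deriv_lt f (m : int) :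
  m < - (ll_ord f).+1%:Z -> dterm (f (m + 1)) (m + 1) = 0.
Proof.
by move=> lt_m; rewrite /dterm ll_coef_lt ?deriv0 ?scaler0 ?addr0 //; lia.
Qed.
Definition ll_deriv f : log_laurent K := LogLaurent (@ll_deriv_lt f).

End FormalOperations.

Section LorenzRhs.
Variable K : numClosedFieldType.
Implicit Types x y z : log_laurent K.

Definition lorenz_x x y := ll_scale 10%:R (ll_sub y x).
Definition lorenz_y x y z :=
  ll_sub (ll_sub (ll_scale 28%:R x) y) (ll_mul x z).
Definition lorenz_z x y z :=
  ll_add (ll_scale (- (8%:R / 3%:R)) z) (ll_mul x y).

Definition formally_satisfies_lorenz x y z : Prop :=
  forall m : int,
    [/\ ll_deriv x m = lorenz_x x y m,
        ll_deriv y m = lorenz_y x y z m &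
        ll_deriv z m = lorenz_z x y z m].

End LorenzRhs.

Section PsiPolynomials.
Variable K : numClosedFieldType.
Implicit Types (D : K) (s : seq 'cV[{poly K}]_3).

Definition col3 (V : nmodType) (a b c : V) : 'cV[V]_3 :=
  \col_(k < 3) nth 0 [:: a; b; c] k.

(* psi_init D lists X_(-2), X_(-1), X_0, X_1, X_2, where
   X_m = (P_(m+1), Q_m, R_m)^T. *)
Definition psi_init D : seq 'cV[{poly K}]_3 :=
  [:: col3
        (2%:R * 'i)%:P
        (- (1 / 5%:R) * 'i)%:P
        (- (1 / 5%:R))%:P;
      col3
        (71%:R / 9%:R * 'i)%:P
        (2%:R * 'i)%:P
        (17%:R / 9%:R)%:P;
      col3
        (- (9880%:R / 81%:R * 'i) *: 'X)
        ((- (349%:R / 81%:R) * 'i)%:P - (988%:R / 81%:R * 'i) *: 'X)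
        ((1385%:R / 54%:R)%:P - (988%:R / 81%:R) *: 'X);
      col3
        ((- (2108195%:R / 972%:R) * 'i)%:P + (469300%:R / 243%:R * 'i) *: 'X)
        ((- (25991%:R / 108%:R) * 'i)%:P + (64220%:R / 243%:R * 'i) *: 'X)
        ((- (211189%:R / 972%:R))%:P + (167960%:R / 729%:R) *: 'X);
      col3
        (('i * D)%:P - (96356411%:R / 6561%:R * 'i) *: 'X
           - (2736760%:R / 6561%:R * 'i) *: 'X^2)
        ((3%:R / 10%:R * 'i * D - 477319147%:R / 131220%:R * 'i)%:P
           - (167831753%:R / 65610%:R * 'i) *: 'X
           - (273676%:R / 2187%:R * 'i) *: 'X^2)
        ((- (1 / 5%:R) * D + 138959125%:R / 17496%:R)%:P
           - (58846039%:R / 32805%:R) *: 'X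
           - (1444456%:R / 2187%:R) *: 'X^2)].

Definition psiA (m : nat) : 'M[K]_3 :=
  \matrix_(i < 3, j < 3)
    nth 0 (nth [::]
      [:: [:: - m%:R - 1;          10%:R;      0          ];
          [:: 1 / 5%:R;            - m%:R;     - 2%:R * 'i];
          [:: - (1 / 5%:R) * 'i;   2%:R * 'i;  - m%:R     ]] i) j.

Definition psiF (P Q R : int -> {poly K}) (m : nat) : 'cV[{poly K}]_3 :=
  let n := m%:Z in
  col3 (- 10%:R *: P n)
       (28%:R *: P (n - 1) - Q (n - 1)
          - \sum_(j < m.+1) P j%:Z * R (n - j%:Z - 1))
       (- (8%:R / 3%:R) *: R (n - 1)
          + \sum_(j < m.+1) P j%:Z * Q (n - j%:Z - 1)).

Definition psi_step (P Q R : int -> {poly K}) (m : nat) : 'cV[{poly K}]_3 :=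
  - \sum_(j < (m + 2)./2.+1)
      map_mx polyC (psiA m ^- j.+1)
        *m map_mx (fun p : {poly K} => p^`(j)) (psiF P Q R m).

(* The list s stores X_m at position m + 2; absent entries read as 0. *)
Definition X_of s (m : int) : 'cV[{poly K}]_3 :=
  if m + 2 is Posz n then nth 0 s n else 0.
Definition P_of s (m : int) : {poly K} := X_of s (m - 1) 0 0.
Definition Q_of s (m : int) : {poly K} := X_of s m 1 0.
Definition R_of s (m : int) : {poly K} := X_of s m 2%:R 0.

(* X_(-2), ..., X_(n + 2). *)
Fixpoint psi_prefix D (n : nat) : seq 'cV[{poly K}]_3 :=
  if n is n'.+1 then
    let s := psi_prefix D n' in
    rcons s (psi_step (P_of s) (Q_of s) (R_of s) n'.+3)
  else psi_init D.

Definition psiX D (m : int) := X_of (psi_prefix D (absz m)) m.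
Definition psiP D (m : int) : {poly K} := psiX D (m - 1) 0 0.
Definition psiQ D (m : int) : {poly K} := psiX D m 1 0.
Definition psiR D (m : int) : {poly K} := psiX D m 2%:R 0.

Lemma size_psi_prefix D n : size (psi_prefix D n) = (n + 5)%N.
Proof. by elim: n => //= n IHn; rewrite size_rcons IHn. Qed.

Lemma psi_prefixS D n k i :
  (i < n + 5)%N -> nth 0 (psi_prefix D (n + k)) i = nth 0 (psi_prefix D n) i.
Proof.
move=> lt_i; elim: k => [|k IHk]; first by rewrite addn0.
rewrite addnS /= nth_rcons size_psi_prefix IHk ifT //; lia.
Qed.

Lemma X_of_psi_prefix D n (m : int) :
  m <= n%:Z + 2 -> X_of (psi_prefix D n) m = psiX D m.
Proof.
move=> le_m; rewrite /psiX /X_of; case Ei: (m + 2) => [i|//].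
case: (leqP n (absz m)) => [le_n|lt_n].
  by rewrite -(subnKC le_n) psi_prefixS //; lia.
by rewrite -(subnKC (ltnW lt_n)) psi_prefixS //; lia.
Qed.

Lemma psiX_lt D (m : int) : m < - 2%:Z -> psiX D m = 0.
Proof. by rewrite /psiX /X_of; case E: (m + 2) => [n|n] //; lia. Qed.

Lemma psiX_init D (k : 'I_5) : psiX D (k%:Z - 2) = nth 0 (psi_init D) k.
Proof.
rewrite -(@X_of_psi_prefix D 0); last by have := ltn_ord k; lia.
by rewrite /X_of subrK.
Qed.

Lemma psi_step_ext P Q R P' Q' R' (m : nat) :
  (forall n : int, n <= m%:Z -> P n = P' n) ->
  (forall n : int, n < m%:Z -> Q n = Q' n) ->
  (forall n : int, n < m%:Z -> R n = R' n) ->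
  psi_step P Q R m = psi_step P' Q' R' m.
Proof.
move=> eP eQ eR; rewrite /psi_step; suff -> : psiF P Q R m = psiF P' Q' R' m by [].
rewrite /psiF eP ?lexx // !(eP (_ - 1)) ?(eQ (_ - 1)) ?(eR (_ - 1)); try lia.
congr (col3 _ (_ - _) (_ + _)); apply: eq_bigr => j _; have := ltn_ord j => ltj;
  by rewrite eP ?eQ ?eR //; lia.
Qed.

Lemma psiX_rec D (m : nat) :
  (3 <= m)%N -> psiX D m = psi_step (psiP D) (psiQ D) (psiR D) m.
Proof.
case: m => [|[|[|m]]] // _.
rewrite -(@X_of_psi_prefix D m.+1); last lia.
rewrite {1}/X_of; have -> : m.+3%:Z + 2 = (m + 5)%N%:Z :> int by lia.
rewrite /= nth_rcons size_psi_prefix ltnn eqxx.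
by apply: psi_step_ext => n le_n;
  rewrite /P_of /Q_of /R_of X_of_psi_prefix //; lia.
Qed.

Lemma psiP_lt D (m : int) : m < - 1%:Z -> psiP D m = 0.
Proof. by move=> lt_m; rewrite /psiP psiX_lt ?mxE //; lia. Qed.

Lemma psiQ_lt D (m : int) : m < - 2%:Z -> psiQ D m = 0.
Proof. by move=> lt_m; rewrite /psiQ psiX_lt ?mxE. Qed.

Lemma psiR_lt D (m : int) : m < - 2%:Z -> psiR D m = 0.
Proof. by move=> lt_m; rewrite /psiR psiX_lt ?mxE. Qed.

(* p(eta + C), as a polynomial in eta. *)
Definition at_eta_plus (C : K) (p : {poly K}) : {poly K} := p \Po ('X + C%:P).

Fact at_eta_plus_lt (C : K) (c : int -> {poly K}) (N : nat) :
  (forall m : int, m < - N%:Z -> c m = 0) ->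
  forall m : int, m < - N%:Z -> at_eta_plus C (c m) = 0.
Proof. by move=> c0 m lt_m; rewrite /at_eta_plus c0 // comp_poly0. Qed.

Definition psi_x C D := LogLaurent (at_eta_plus_lt C (@psiP_lt D)).
Definition psi_y C D := LogLaurent (at_eta_plus_lt C (@psiQ_lt D)).
Definition psi_z C D := LogLaurent (at_eta_plus_lt C (@psiR_lt D)).

End PsiPolynomials.

Section Realization.
Variable R : realType.

(* R[i]^o is R[i] seen as a normed space over itself, so that is_derive and
   open have their complex meaning. *)
Local Notation C := (R[i]^o).

Definition cexp (z : C) : C :=
  (expR (complex.Re z) * cos (complex.Im z)
   +i* (expR (complex.Re z) * sin (complex.Im z)))%C.

Definition log_branch (V : set C) (l : C -> C) : Prop :=
  [/\ open V, (forall w, V w -> {for w, continuous l}) &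
      forall w, V w -> cexp (l w) = w].

Definition ll_term (t0 : C) (eta : C -> C) (f : log_laurent R[i]) (m : int) :
    C -> C :=
  fun t => (f m).[eta t] * (t - t0) ^ m.

(* On U, eta is differentiable with eta' = 1/(t - t0), and the formal
   differentiation rule is the actual one. *)
Definition valid_eta (U : set C) (t0 : C) (eta : C -> C) : Prop :=
  forall t, U t ->
    is_derive t 1 eta (t - t0)^-1 /\
    forall (p : {poly R[i]}) (m : int),
      is_derive t (1 : C) (fun s : C => p.[eta s] * (s - t0) ^ m : C)
        ((dterm p m).[eta t] * (t - t0) ^ (m - 1)).

(* The Lorenz system on U, order by order in t - t0, with the terms of the
   series differentiated as functions of t. *)
Definition satisfies_lorenz_termwise (U : set C) (t0 : C) (eta : C -> C)
    (x y z : log_laurent R[i]) : Prop :=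
  forall (m : int) (t : C), U t ->
    [/\ is_derive t (1 : C) (ll_term t0 eta x (m + 1))
          (ll_term t0 eta (lorenz_x x y) m t),
        is_derive t (1 : C) (ll_term t0 eta y (m + 1))
          (ll_term t0 eta (lorenz_y x y z) m t) &
        is_derive t (1 : C) (ll_term t0 eta z (m + 1))
          (ll_term t0 eta (lorenz_z x y z) m t)].

End Realization.

(* log_branch is inhabited for the usual cut: principal_log is the branch with
   imaginary part in ]-pi, pi[, arg w = 2 atan (Im w / (|w| + Re w)), off the
   half-line ]-oo, 0]; the factor b in log (b (t - t0)) rotates this cut. *)
Section PrincipalLog.
Variable R : realType.
Local Notation C := (R[i]^o).
Let modulus (w : C) : R :=
  Num.sqrt (complex.Re w ^+ 2 + complex.Im w ^+ 2).

Definition principal_log (w : C) : C :=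
  (ln (modulus w)
   +i* (atan (complex.Im w / (modulus w + complex.Re w)) *+ 2))%C.

Let normIm_le (w : C) : `|complex.Im w|%:C%C <= `|w|.
Proof.
rewrite normc_def lecR -sqrtr_sqr ler_wsqrtr // lerDr; exact: sqr_ge0.
Qed.

Let continuous_Re : continuous (@complex.Re R : C -> R^o).
Proof.
move=> w; apply/(@cvgrPdist_lt _ R^o _ _ (nbhs_filter (w : C))) => e e0.
have e0C : 0 < (e%:C%C : C) by rewrite ltcR.
have near_w : \forall v \near w, `|w - v| < (e%:C%C : C).
  by have := @nbhsx_ballx _ C w _ e0C; rewrite -ball_normE.
apply: filterS near_w => v; rewrite -ltcR -raddfB; apply: le_lt_trans.
exact: normc_ge_Re.
Qed.

Let continuous_Im : continuous (@complex.Im R : C -> R^o).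
Proof.
move=> w; apply/(@cvgrPdist_lt _ R^o _ _ (nbhs_filter (w : C))) => e e0.
have e0C : 0 < (e%:C%C : C) by rewrite ltcR.
have near_w : \forall v \near w, `|w - v| < (e%:C%C : C).
  by have := @nbhsx_ballx _ C w _ e0C; rewrite -ball_normE.
apply: filterS near_w => v; rewrite -ltcR -raddfB; apply: le_lt_trans.
exact: normIm_le.
Qed.

Let continuous_complex (u v : C -> R^o) (w : C) :
  {for w, continuous u} -> {for w, continuous v} ->
  {for w, continuous (fun s => (u s +i* v s)%C : C)}.
Proof.
move=> cu cv; apply/(@cvgrPdist_lt _ C _ _ (nbhs_filter (w : C))) => -[e e'] /=.
rewrite ltcE /= => /andP[/eqP-> {e'} e0].
have e20 : 0 < e / 2 by rewrite divr_gt0.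
near=> s.
have -> : ((u w +i* v w) - (u s +i* v s) = (u w - u s)%:C + Complex 0 (v w - v s))%C.
  by apply/eqP; rewrite eq_complex /= addr0 add0r !eqxx.
apply: le_lt_trans (ler_normD _ _) _.
rewrite !normc_def /= expr0n /= addr0 add0r !sqrtr_sqr -rmorphD ltcR (splitr e).
by rewrite ltrD //; near: s; apply: cvgr_dist_lt.
Unshelve. all: by end_near. Qed.

Let continuous_modulus : continuous (modulus : C -> R^o).
Proof.
move=> w; apply: (@continuous_comp _ _ _ (fun w : C => complex.Re w ^+ 2 + complex.Im w ^+ 2 : R^o)).
  have cX (f : C -> R^o) : continuous f -> {for w, continuous (fun v => f v ^+ 2 : R^o)}.
    by move=> cf; apply: (@continuousM _ _ f f w); exact: cf.
  by apply: continuousD; apply: cX; [exact: continuous_Re|exact: continuous_Im].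
exact: sqrt_continuous.
Qed.

Let slitP (w : C) : ~ (complex.Im w = 0 /\ complex.Re w <= 0) ->
  0 < modulus w + complex.Re w.
Proof.
case: w => a b /= nw; rewrite /modulus /=.
have [a0|a0] := ltP 0 a; first by rewrite ltr_wpDl // sqrtr_ge0.
have b0 : b != 0 by apply/eqP => b0; apply: nw.
rewrite -ltrBlDr sub0r -[- a]ger0_norm ?oppr_ge0 // -sqrtr_sqr ltr_sqrt.
  by rewrite sqrrN ltrDl exprn_even_gt0.
by rewrite ltr_wpDl ?sqr_ge0 // exprn_even_gt0.
Qed.

Lemma principal_log_branch :
  log_branch [set w : C | ~ (complex.Im w = 0 /\ complex.Re w <= 0)]
    principal_log.
Proof.
have cd : continuous (fun w : C => modulus w + complex.Re w : R^o).
  by move=> w; apply: continuousD; [exact: continuous_modulus|exact: continuous_Re].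
split=> [|w /slitP mRw|w /slitP mRw].
- rewrite (_ : mkset _ = (fun w : C => modulus w + complex.Re w : R^o) @^-1` [set r | 0 < r]).
    by apply: open_comp => [w _|]; [exact: cd|exact: open_gt].
  apply/seteqP; split=> w /=; first exact: slitP.
  move=> + [w0 w1]; rewrite /modulus w0 expr0n addr0 sqrtr_sqr ler0_norm //.
  by rewrite addNr ltxx.
- have m0 : 0 < modulus w.
    rewrite lt_def sqrtr_ge0 andbT; apply/eqP => m0.
    move: (mRw) (m0); rewrite {1}m0 add0r => a0 /eqP; rewrite sqrtr_eq0 leNgt.
    by rewrite ltr_wpDr ?sqr_ge0 // exprn_gt0.
  apply: continuous_complex.
    apply: (@continuous_comp _ _ _ (modulus : C -> R^o)); first exact: continuous_modulus.
    exact: continuous_ln.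
  apply: (@continuous_comp _ _ _ _ (fun r : R^o => r *+ 2)); last first.
    exact: natmul_continuous.
  apply: (@continuous_comp _ _ _ (fun w : C => complex.Im w / (modulus w + complex.Re w) : R^o)); last exact: continuous_atan.
  apply: continuousM; first exact: continuous_Im.
  by apply: continuousV; [rewrite gt_eqF|exact: cd].
case: w mRw => a b mRw; rewrite /cexp /principal_log /=.
set m := modulus _ in mRw *; rewrite /= in mRw *.
have m2 : m ^+ 2 = a ^+ 2 + b ^+ 2 by rewrite sqr_sqrtr // addr_ge0 ?sqr_ge0.
have m0 : 0 < m.
  rewrite lt_def sqrtr_ge0 andbT; apply/eqP => m0; move: m2 mRw; rewrite m0.
  nra.
rewrite lnK ?posrE //; set k := b / _.
have ck : cos (atan k) ^+ 2 = (m + a) / (2 * m).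
  rewrite cos_atan exprVn sqr_sqrtr ?addr_ge0 ?sqr_ge0 // /k.
  have -> : 1 + (b / (m + a)) ^+ 2 = 2 * m / (m + a).
    rewrite exprMn exprVn (_ : b ^+ 2 = m ^+ 2 - a ^+ 2); last by rewrite m2; ring.
    by field; rewrite gt_eqF.
  by rewrite invf_div.
have sk : sin (atan k) = k * cos (atan k).
  rewrite -{2}(atanK k) /tan divfK //.
  by rewrite cos_atan invr_eq0 sqrtr_eq0 -ltNge ltr_wpDr ?sqr_ge0.
rewrite cos_mulr2n sin_mulr2n sk mulrCA -expr2 ck /k.
congr Complex; field; rewrite ?gt_eqF //.
Qed.
End PrincipalLog.

(* Main.v *)
Require Import Defs.
From mathcomp Require Import all_boot all_order all_algebra zify ring lra.
From mathcomp Require Import all_classical all_reals all_analysis.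
From mathcomp Require Import complex.

(* Write X_m = (P_(m+1), Q_m, R_m)^T.  Equating coefficients, the Lorenz system
   says X_m' = A_m X_m + F_m for every m.  For m >= 3 the recursion is the
   Neumann series of (d/du - A_m)^-1 F_m; it is an exact solution because the
   degree of F_m is at most (m + 2)/2, so the truncation loses nothing.  For
   m <= 2 the given values are checked directly (A_0 and A_2 are singular, which
   is where the free constants C and D come from).  Translation by C commutes
   with d/d eta, and the sign flip is a symmetry of the system.  Finally
   eta = log (b (t - t0)) enters only through d eta/dt = 1/(t - t0), which
   follows from the derivative of exp at 0 by inverting difference quotients. *)

Set Implicit Arguments.
Unset Strict Implicit.
Unset Printing Implicit Defensive.

Import Order.TTheory GRing.Theory Num.Theory.
Import numFieldNormedType.Exports.

Local Open Scope classical_set_scope.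
Local Open Scope ring_scope.

(** * Polynomial solutions of X' = A X + F by a finite Neumann series *)

Section LinearRecursion.
Variables (K : numFieldType) (n : nat).
Implicit Types (A : 'M[K]_n.+1) (F : 'cV[{poly K}]_n.+1).

Lemma deriv_mulCmx m p (A : 'M[K]_(m, n.+1)) (F : 'M[{poly K}]_(n.+1, p)) :
  map_mx (fun q : {poly K} => q^`()) (map_mx polyC A *m F) =
  map_mx polyC A *m map_mx (fun q : {poly K} => q^`()) F.
Proof.
apply/matrixP => i j; rewrite !mxE (big_morph _ (@derivD K) (deriv0 K)).
apply: eq_bigr => k _.
by rewrite !mxE derivM derivC mul0r add0r.
Qed.

(* Applying d/du - A telescopes the finite Neumann series of (d/du - A)^-1. *)
Lemma deriv_neumann A F (N : nat) :
  A \in unitmx -> (forall k, (size (F k 0%R) <= N)%N) ->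
  let X := - \sum_(j < N)
      map_mx polyC (A ^- j.+1) *m map_mx (fun p : {poly K} => p^`(j)) F in
  map_mx (fun p : {poly K} => p^`()) X = map_mx polyC A *m X + F.
Proof.
move=> uA sF X; pose G j := map_mx polyC (A ^- j) *m
  map_mx (fun p : {poly K} => p^`(j)) F.
have dX : map_mx (fun p : {poly K} => p^`()) X = - \sum_(j < N) G j.+1.
  have -> : X = - \sum_(j < N) map_mx polyC (A ^- j.+1) *m
     map_mx (fun p : {poly K} => p^`(j)) F by [].
  apply/matrixP => i j; rewrite !mxE derivN !summxE.
  rewrite (big_morph _ (@derivD K) (deriv0 K)); congr (- _).
  apply: eq_bigr => k _.
  have := congr1 (fun M : 'cV[{poly K}]_n.+1 => M i j) (deriv_mulCmx (A ^- k.+1)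
     (map_mx (fun p : {poly K} => p^`(k)) F)).
  rewrite mxE => ->; congr (_ _ _); rewrite /G; congr (_ *m _).
  by apply/matrixP => ? ?; rewrite !mxE.
have AX : map_mx polyC A *m X = - \sum_(j < N) G j.
  rewrite /X mulmxN mulmx_sumr; congr (- _); apply: eq_bigr => j _.
  rewrite mulmxA -map_mxM /G /=; congr (map_mx _ _ *m _).
  by rewrite -[_ *m _]/(_ * _) exprSr invrM ?unitrX // mulVKr.
have G0 : G 0%N = F.
  rewrite /G expr0 invr1 map_mx1 mul1mx.
  by apply/matrixP => i j; rewrite !mxE derivn0.
(* This is the remainder of the telescoping: [N] derivatives annihilate every entry of [F], whose
   size is at most [N]. *)
have GN : G N = 0.
  rewrite /G (_ : map_mx _ F = 0) ?mulmx0 //.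
  by apply/matrixP => i j; rewrite !mxE ord1 derivn_poly0.
rewrite dX AX -[in RHS]G0.
have -> : \sum_(j < N) G j = G 0%N + \sum_(j < N) G j.+1.
  transitivity (\sum_(j < N.+1) G j); last by rewrite big_ord_recl.
  by rewrite big_ord_recr /= GN addr0.
by rewrite opprD addrAC addNr add0r.
Qed.

Lemma size_mulCmx_le A F (N : nat) : (forall k, (size (F k 0%R) <= N)%N) ->
  forall k, (size ((map_mx polyC A *m F) k 0%R) <= N)%N.
Proof.
move=> sF k; rewrite mxE; apply: leq_trans (size_sum _ _ _) _.
apply/bigmax_leqP => i _; rewrite !mxE mul_polyC.
exact: leq_trans (size_scale_leq _ _) (sF i).
Qed.

End LinearRecursion.

(** * Invertibility of A_m, and testing polynomial identities pointwise *)

Lemma det_mx22 (T : comNzRingType) (M : 'M[T]_2) :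
  \det M = M 0 0 * M 1 1 - M 0 1 * M 1 0.
Proof.
rewrite (expand_det_row _ 0) !big_ord_recl big_ord0 /cofactor !det_mx11 !mxE /=.
rewrite addr0 expr0 mul1r expr1 mulN1r mulrN.
by congr (_ * M _ _ - M _ _ * M _ _); apply/val_inj.
Qed.

Lemma det_mx33 (T : comNzRingType) (M : 'M[T]_3) :
  \det M = M 0 0 * (M 1 1 * M 2%:R 2%:R - M 1 2%:R * M 2%:R 1)
         - M 0 1 * (M 1 0 * M 2%:R 2%:R - M 1 2%:R * M 2%:R 0)
         + M 0 2%:R * (M 1 0 * M 2%:R 1 - M 1 1 * M 2%:R 0).
Proof.
rewrite (expand_det_row _ 0) !big_ord_recl big_ord0 /cofactor !det_mx22 !mxE /=.
do ![rewrite [lift _ _](_ : _ = 0); last exact/val_inj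
    |rewrite [lift _ _](_ : _ = 1); last exact/val_inj
    |rewrite [lift _ _](_ : _ = 2%:R); last exact/val_inj].
by rewrite /bump /= addr0 expr0 expr1 sqrrN expr1n !mul1r mulN1r mulrN addrA.
Qed.

(** The determinant is the product of the eigenvalues 2 - m, -m and -m - 3, which are all nonzero
    once m > 2. *)
Lemma psiA_unit (K : numClosedFieldType) (m : nat) :
  (2 < m)%N -> psiA K m \in unitmx.
Proof.
move=> m3; rewrite unitmxE unitfE.
have -> : \det (psiA K m) = - ((m%:R - 2%:R) * m%:R * (m%:R + 3%:R)).
  rewrite det_mx33 !mxE /=.
  have i2 : 'i ^+ 2 = - 1 :> K by exact: sqrCi.
  by field: i2.
rewrite oppr_eq0 !mulf_eq0 !negb_or subr_eq0 -natrD !pnatr_eq0 eqr_nat; lia.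
Qed.

(** Otherwise p - q, of size n, would have the n distinct roots 0, ..., n - 1. This turns the
    polynomial identities for the initial values into scalar identities in u. *)
Lemma poly_horner_inj (K : numDomainType) (p q : {poly K}) :
  (forall u, p.[u] = q.[u]) -> p = q.
Proof.
move=> epq; apply/eqP; rewrite -subr_eq0; apply/negPn/negP => nz_r.
have := @max_poly_roots _ _ [seq i%:R | i <- iota 0 (size (p - q))] nz_r.
rewrite size_map size_iota ltnn map_inj_uniq ?iota_uniq; last first.
  by move=> i j /eqP; rewrite eqr_nat => /eqP.
suff -> : all (root (p - q)) [seq i%:R | i <- iota 0 (size (p - q))].
  by move=> /(_ isT isT).
by apply/allP => _ /mapP[i _ ->]; rewrite rootE !hornerE epq subrr.
Qed.

(** * Degree bound: the entries of X_m have degree at most (m + 2)/2 *)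

Section PsiDegree.
Variables (K : numClosedFieldType) (D : K).

Lemma size_psi_init (k : 'I_5) (i : 'I_3) :
  (size (nth 0%R (psi_init D) k i 0%R) <= k./2.+1)%N.
Proof.
rewrite /psi_init.
(* Simplification would expand the large numerals to unary, so they are
   abstracted first. *)
repeat match goal with |- context [?a%:R / ?b%:R] =>
  generalize (a%:R / b%:R : K); intro end.
apply/leq_sizeP => j.
case: k => -[|[|[|[|[|k]]]]] // lt_k;
  case: i => -[|[|[|i]]] // lt_i; rewrite !mxE /= => lt_j;
  by rewrite !coefE; case: j lt_j => [|[|[|j]]] //= _;
     rewrite ?mulr0 ?subr0 ?addr0.
Qed.

(** The degrees add up to (j + 1)/2 + (m - j + 1)/2 = (m + 2)/2 in each product. Quantifying over
    [r] expresses the bounds without halving an integer, and at [r = 0] it makes the terms below the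
    range vanish. *)
Lemma size_psiF (P Q R : int -> {poly K}) (m : nat) :
  (forall (j : int) (r : nat), j <= m%:Z -> j + 1 < r.*2%:Z ->
    (size (P j) <= r)%N) ->
  (forall (j : int) (r : nat), j < m%:Z -> j + 2 < r.*2%:Z ->
    (size (Q j) <= r)%N) ->
  (forall (j : int) (r : nat), j < m%:Z -> j + 2 < r.*2%:Z ->
    (size (R j) <= r)%N) ->
  forall k, (size (psiF P Q R m k 0%R) <= (m + 2)./2.+1)%N.
Proof.
move=> IHP IHQ IHR k.
have sM (S : int -> {poly K}) (j : 'I_m.+1) :
    (forall (j : int) (r : nat), j < m%:Z -> j + 2 < r.*2%:Z ->
      (size (S j) <= r)%N) ->
    (size (P j%:Z * S (m%:Z - j%:Z - 1))%R <= (m + 2)./2.+1)%N.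
  move=> IHS; have lt_j := ltn_ord j; apply: leq_trans (size_polyMleq _ _) _.
  have h1 : (size (P j%:Z) <= j.+1./2.+1)%N by apply: IHP; lia.
  have h2 : (size (S (m%:Z - j%:Z - 1)%R) <= (m.+1 - j)./2.+1)%N.
    by apply: IHS; lia.
  by lia.
case: k => -[|[|[|k]]] // lt_k; rewrite !mxE /=.
- apply: leq_trans (size_scale_leq _ _) _; apply: IHP => //; lia.
- rewrite (leq_trans (size_polyD _ _)) // geq_max size_polyN; apply/andP; split.
    rewrite (leq_trans (size_polyD _ _)) // geq_max size_polyN.
    rewrite (leq_trans (size_scale_leq _ _)) ?IHP ?IHQ //; lia.
  by apply: leq_trans (size_sum _ _ _) _; apply/bigmax_leqP => j _; apply: sM.
- rewrite (leq_trans (size_polyD _ _)) // geq_max; apply/andP; split.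
    rewrite (leq_trans (size_scale_leq _ _)) ?IHR //; lia.
  by apply: leq_trans (size_sum _ _ _) _; apply/bigmax_leqP => j _; apply: sM.
Qed.

(** Strong induction on m + 2: F_m satisfies the bound, and neither differentiation nor a constant
    matrix raises the degree. *)
Lemma size_psiX (m : int) (i : 'I_3) (q : nat) :
  m + 2 < q.*2%:Z -> (size (psiX D m i 0%R) <= q)%N.
Proof.
have [lt_m|] := ltP m (- 2%:Z); first by rewrite psiX_lt ?mxE ?size_poly0.
move=> le_m lt_q.
have {le_m} [n def_m] : exists n : nat, m = n%:Z - 2.
  by exists (absz (m + 2)); lia.
have {lt_q} lt_q : (n./2.+1 <= q)%N by lia.
apply: leq_trans lt_q; rewrite {}def_m => {m}.
elim/ltn_ind: n i => n IHn i.
have [lt_n5|le5n] := ltnP n 5.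
  by have := size_psi_init (Ordinal lt_n5) i; rewrite -psiX_init.
have IH (m' : int) (k : 'I_3) (r : nat) : m' < n%:Z - 2 -> m' + 2 < r.*2%:Z ->
    (size (psiX D m' k 0%R) <= r)%N.
  have [lt_m|le_m] := ltP m' (- 2%:Z).
    by rewrite psiX_lt ?mxE ?size_poly0.
  move=> lt_m lt_r; rewrite (_ : m' = (absz (m' + 2))%:Z - 2); last by lia.
  by apply: leq_trans (IHn _ _ k) _; lia.
have {IHn le5n} [m def_n le3m] : exists2 m : nat, n = m.+2 & (2 < m)%N.
  by exists (n - 2)%N; lia.
rewrite {}def_n in IH *; have -> : m.+2%:Z - 2 = m%:Z by lia.
rewrite psiX_rec //.
rewrite /psi_step mxE size_polyN summxE.
apply: leq_trans (size_sum _ _ _) _; apply/bigmax_leqP => j _.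
apply: size_mulCmx_le => k; rewrite mxE.
have sF : (size (psiF (psiP D) (psiQ D) (psiR D) m k 0%R) <= m.+2./2.+1)%N.
  by rewrite -[m.+2]addn2; apply: size_psiF => j' r lt_j lt_r; apply: IH; lia.
apply: leq_trans sF; apply/leq_sizeP => i0 le_i0.
by rewrite coef_derivn nth_default ?mul0rn // (leq_trans le_i0) ?leq_addl.
Qed.
End PsiDegree.

(** * The Lorenz equations order by order in t - t0 *)

Section Formal.
Variables (K : numClosedFieldType) (D : K).

(** The recursion has as many terms as the size bound on F_m, so the Neumann series is complete. *)
Lemma psiX_ode (m : nat) : (2 < m)%N ->
  map_mx (fun p : {poly K} => p^`()) (psiX D m) =
  map_mx polyC (psiA K m) *m psiX D m + psiF (psiP D) (psiQ D) (psiR D) m.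
Proof.
move=> lt2m; rewrite psiX_rec //; apply: deriv_neumann; first exact: psiA_unit.
by apply: size_psiF => j r _ lt_r; apply: size_psiX; lia.
Qed.

Lemma psiA_mul (m : nat) (X : 'cV[{poly K}]_3) :
  map_mx polyC (psiA K m) *m X =
  col3 (- (m%:R + 1) *: X 0 0 + 10%:R *: X 1 0)
       ((1 / 5%:R) *: X 0 0 - m%:R *: X 1 0 - (2%:R * 'i) *: X 2%:R 0)
       (- (1 / 5%:R * 'i) *: X 0 0 + (2%:R * 'i) *: X 1 0 - m%:R *: X 2%:R 0).
Proof.
have e1 : lift ord0 ord0 = 1 :> 'I_3 by apply/val_inj.
have e2 : lift ord0 (lift ord0 ord0) = 2%:R :> 'I_3 by apply/val_inj.
apply/matrixP => k j; rewrite ord1 !mxE !big_ord_recl big_ord0 !mxE e1 e2.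
case: k => -[|[|[|k]]] // lt_k; rewrite /= -!mul_polyC /=; ring.
Qed.

Lemma psiPQR_ode (m : nat) : (2 < m)%N ->
  [/\ (psiP D (m%:Z + 1))^`() = - (m%:R + 1) *: psiP D (m%:Z + 1)
         + 10%:R *: psiQ D m - 10%:R *: psiP D m,
      (psiQ D m)^`() =
         (1 / 5%:R) *: psiP D (m%:Z + 1) - m%:R *: psiQ D m
         - (2%:R * 'i) *: psiR D m
         + (28%:R *: psiP D (m%:Z - 1) - psiQ D (m%:Z - 1)
          - \sum_(j < m.+1) psiP D j%:Z * psiR D (m%:Z - j%:Z - 1)) &
      (psiR D m)^`() =
         - (1 / 5%:R * 'i) *: psiP D (m%:Z + 1) + (2%:R * 'i) *: psiQ D m
         - m%:R *: psiR D m
         + (- (8%:R / 3%:R) *: psiR D (m%:Z - 1)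
          + \sum_(j < m.+1) psiP D j%:Z * psiQ D (m%:Z - j%:Z - 1))].
Proof.
move=> /psiX_ode ode; rewrite psiA_mul in ode.
have e k := congr1 (fun X : 'cV_3 => X k 0) ode.
rewrite /psiP addrK; split.
- by have := e 0; rewrite !mxE /= => ->; rewrite (scaleNr 10%:R).
- by have := e 1; rewrite !mxE /= => ->.
- by have := e 2%:R; rewrite !mxE /= => ->.
Qed.

(* The Lorenz equations for X_(k - 2), with p i, q i, r i standing for
   P_(i - 3), Q_(i - 3), R_(i - 3): order k - 2 in t - t0 for x, order k - 3
   for y and z. *)
Definition lorenz_coef (p q r : nat -> {poly K}) (k : nat) : Prop :=
  [/\ dterm (p k.+2) (k%:Z - 1) = 10%:R *: (q k.+1 - p k.+1),
      dterm (q k.+1) (k%:Z - 2) =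
        28%:R *: p k - q k - \sum_(j < k.+1) p j.+2 * r (k - j).+1 &
      dterm (r k.+1) (k%:Z - 2) =
        - (8%:R / 3%:R) *: r k + \sum_(j < k.+1) p j.+2 * q (k - j).+1].

Let p k := psiP D (k%:Z - 3).
Let q k := psiQ D (k%:Z - 3).
Let r k := psiR D (k%:Z - 3).

Lemma psi_leading :
  [/\ psiP D (- 1) = (2%:R * 'i)%:P, psiQ D (- 2) = (- (1 / 5%:R) * 'i)%:P &
      psiR D (- 2) = (- (1 / 5%:R))%:P].
Proof.
have e k : psiX D (- 2) k 0 = _ := congr1 (fun X : 'cV_3 => X k 0)
  (psiX_init D (@Ordinal 5 0 isT)).
by split; [rewrite /psiP|rewrite /psiQ|rewrite /psiR]; rewrite e mxE.
Qed.

(** With k = m + 2, the two extreme terms of each convolution pair a leading coefficient P_(-1),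
    Q_(-2) or R_(-2) with an entry of X_m. They supply the entries 1/5, -2i, -i/5 and 2i of A_m; the
    inner terms form the sums in F_m. *)
Lemma lorenz_coef_rec (k : nat) : (4 < k)%N ->
  lorenz_coef p q r k.
Proof.
case: k => [|[|m]] // lt2m.
have conv (S : int -> {poly K}) :
    \sum_(j < m.+3) p j.+2 * S ((m.+2 - j).+1%:Z - 3) =
    psiP D (- 1) * S m%:Z + \sum_(j < m.+1) psiP D j%:Z * S (m%:Z - j%:Z - 1)
      + psiP D (m%:Z + 1) * S (- 2).
  rewrite /p big_ord_recl big_ord_recr /= addrA /bump /=.
  congr (psiP D _ * S _ + _ + psiP D _ * S _); try by lia.
  apply: eq_bigr => j _; have := ltn_ord j; move: (nat_of_ord j) => i lt_i.
  by congr (psiP D _ * S _); lia.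
rewrite /lorenz_coef; have [eP eQ eR] := psiPQR_ode lt2m.
have [P1 Q2 R2] := psi_leading.
have e1 : m.+2%:Z - 1 = m%:Z + 1 by lia.
have e2 : m.+2%:Z - 2 = m%:Z by lia.
have e3 : m.+2%:Z - 3 = m%:Z - 1 by lia.
have e4 : m.+3%:Z - 3 = m%:Z by lia.
have e5 : m.+4%:Z - 3 = m%:Z + 1 by lia.
rewrite !conv /p /q /r.
split; rewrite ?e1 ?e2 ?e3 ?e4 ?e5 /dterm ?eP ?eQ ?eR ?P1 ?Q2 ?R2
  -!mul_polyC; ring.
Qed.

(** For k < 5 the equations read only X_(-2), ..., X_2. Two zeros pad the first list because P
    starts at -1 = 2 - 3; one zero pads the others because Q and R start at -2 = 1 - 3. *)
Lemma lorenz_coef_nth (s : seq 'cV[{poly K}]_3) (k : nat) :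
  (forall i : 'I_5, psiX D (i%:Z - 2) = nth 0 s i) -> size s = 5%N ->
  (k < 5)%N ->
  lorenz_coef (nth 0 [:: 0, 0 & [seq X 0 0 | X : 'cV_3 <- s]])
    (nth 0 (0 :: [seq X 1 0 | X : 'cV_3 <- s]))
    (nth 0 (0 :: [seq X 2%:R 0 | X : 'cV_3 <- s])) k ->
  lorenz_coef p q r k.
Proof.
move=> sE sz_s lt_k.
have row (i : 'I_3) n : (n < 5)%N ->
    nth 0 [seq X i 0 | X : 'cV_3 <- s] n = psiX D (n%:Z - 2) i 0.
  by move=> lt_n; rewrite (nth_map 0) ?sz_s // (sE (Ordinal lt_n)).
have pE n : (n < 7)%N -> nth 0 [:: 0, 0 & [seq X 0 0 | X : 'cV_3 <- s]] n = p n.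
  case: n => [|[|n]] lt_n; rewrite /p; [by rewrite psiP_lt|by rewrite psiP_lt|].
  rewrite /= row // /psiP.
  by congr (psiX D _ _ _); lia.
have qE n : (n < 6)%N -> nth 0 (0 :: [seq X 1 0 | X : 'cV_3 <- s]) n = q n.
  case: n => [|n] lt_n; rewrite /q; first by rewrite psiQ_lt.
  by rewrite /= row // /psiQ.
have rE n : (n < 6)%N -> nth 0 (0 :: [seq X 2%:R 0 | X : 'cV_3 <- s]) n = r n.
  case: n => [|n] lt_n; rewrite /r; first by rewrite psiR_lt.
  by rewrite /= row // /psiR.
rewrite /lorenz_coef !pE ?qE ?rE; try by lia.
case=> -> -> ->; split=> //; [congr (_ - _)|congr (_ + _)];
  by apply: eq_bigr => j _; have := ltn_ord j => lt_j;
     rewrite pE ?qE ?rE //; lia.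
Qed.

Lemma lorenz_coef_init (k : nat) : (k < 5)%N -> lorenz_coef p q r k.
Proof.
move=> lt_k; apply: (lorenz_coef_nth (psiX_init D) (size_psi_prefix D 0) lt_k).
have i2 : 'i ^+ 2 = - 1 :> K by exact: sqrCi.
rewrite /psi_init.
(* The fractions are named during simplification; their values return with [subst], just before
   [field]. *)
repeat match goal with |- context [?a%:R / ?b%:R] =>
  let s := fresh "s" in let E := fresh "E" in
    remember (a%:R / b%:R : K) as s eqn:E
end.
rewrite /= /lorenz_coef !mxE /=.
case: k lt_k => [|[|[|[|[|k]]]]] // _;
  rewrite !big_ord_recl !big_ord0 /= /bump /=.
all: split; apply: poly_horner_inj => u; rewrite /dterm ?poly.derivE !hornerE.
all: rewrite /=; subst; field: i2; exact: isT.
Qed.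

(** Order m of the x equation is the case k = m + 2 of [lorenz_coef], and order m of the y and z
    equations is the case k = m + 3. Below these ranges both sides vanish. *)
Lemma psi_formal (f g h : log_laurent K) :
  (forall m, f m = psiP D m) -> (forall m, g m = psiQ D m) ->
  (forall m, h m = psiR D m) -> ll_ord f = 1%N -> ll_ord g = 2%N ->
  ll_ord h = 2%N -> formally_satisfies_lorenz f g h.
Proof.
move=> fE gE hE f1 g2 h2 m.
have eqs k : lorenz_coef p q r k.
  by have [|] := ltnP k 5; [exact: lorenz_coef_init|exact: lorenz_coef_rec].
have eqx : ll_deriv f m = lorenz_x f g m.
  rewrite /= !fE gE; have [lt_m|le_m] := ltP m (- 2%:Z).
    by rewrite psiQ_lt // !psiP_lt ?subr0 ?scaler0 /dterm ?deriv0 ?scaler0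
      ?addr0 //; lia.
  have [] := eqs (absz (m + 2)); rewrite /p /q.
  have -> : (absz (m + 2))%:Z - 1 = m + 1 by lia.
  have -> : (absz (m + 2)).+2%:Z - 3 = m + 1 by lia.
  by have -> : (absz (m + 2)).+1%:Z - 3 = m by lia.
(* The orders 1 and 2 fix the range of the Cauchy product: it starts at P_(-1) and has m + 4
   terms. *)
have conv (f' g' : log_laurent K) (Q : int -> {poly K}) :
    (forall m, f' m = psiP D m) -> (forall m, g' m = Q m) ->
    ll_ord f' = 1%N -> ll_ord g' = 2%N -> - 3%:Z <= m ->
    ll_mul_coef f' g' m =
    \sum_(j < (absz (m + 3)).+1) p j.+2 * Q ((absz (m + 3) - j).+1%:Z - 3).
  move=> f'E g'E f'1 g'2 le_m; rewrite /ll_mul_coef f'1 g'2 -addrA /p.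
  apply: eq_bigr => j _; have := ltn_ord j; move: (nat_of_ord j) => i.
  by rewrite f'E g'E => lt_i; congr (psiP D _ * Q _); lia.
have [lt_m|le_m] := ltP m (- 3%:Z).
  split=> //=.
    rewrite !gE fE ll_mul_lt ?f1 ?h2 ?psiP_lt ?(@psiQ_lt _ _ m)
      ?(@psiQ_lt _ _ (m + 1)) /dterm ?deriv0 ?scaler0
      ?addr0 ?subr0 //; lia.
  rewrite !hE ll_mul_lt ?f1 ?g2 ?(@psiR_lt _ _ m)
    ?(@psiR_lt _ _ (m + 1)) /dterm ?deriv0 ?scaler0 ?addr0 //;
      lia.
have [] := eqs (absz (m + 3)); rewrite /p /q /r.
have -> : (absz (m + 3)).+1%:Z - 3 = m + 1 by lia.
have -> : (absz (m + 3))%:Z - 2 = m + 1 by lia.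
have -> : (absz (m + 3))%:Z - 3 = m by lia.
move=> _ eqy eqz; split=> //=.
  by rewrite !gE fE (conv f h (psiR D)).
by rewrite !hE (conv f g (psiQ D)).
Qed.

End Formal.

(** * Sign flip and translation of eta *)

Section Symmetries.
Variable K : numClosedFieldType.
Implicit Types (x y z : log_laurent K) (p q : {poly K}).

Lemma dtermN p (m : int) : dterm (- p) m = - dterm p m.
Proof. by rewrite /dterm derivN scalerN opprD. Qed.

Lemma dterm_shift (c : K) p (m : int) :
  dterm (p \Po ('X + c%:P)) m = dterm p m \Po ('X + c%:P).
Proof.
by rewrite /dterm deriv_comp derivD derivX derivC addr0 mulr1 comp_polyD
  comp_polyZ.
Qed.

Lemma ll_mul_coefNl x y (m : int) :
  ll_mul_coef (ll_opp x) y m = - ll_mul_coef x y m.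
Proof. by rewrite -sumrN; apply: eq_bigr => k _; rewrite mulNr. Qed.

Lemma ll_mul_coefNr x y (m : int) :
  ll_mul_coef x (ll_opp y) m = - ll_mul_coef x y m.
Proof. by rewrite -sumrN; apply: eq_bigr => k _; rewrite mulrN. Qed.

(** The first two equations are odd in (x, y), since xz is; the third is even, since xy is. *)
Lemma formally_satisfies_lorenzN x y z :
  formally_satisfies_lorenz x y z ->
  formally_satisfies_lorenz (ll_opp x) (ll_opp y) z.
Proof.
move=> xyz m; have [] := xyz m; rewrite /= => ex ey ez; split; rewrite /=.
- by rewrite dtermN ex -scalerN opprB opprK addrC.
- by rewrite dtermN ey ll_mul_coefNl scalerN !opprD.
- by rewrite ll_mul_coefNl ll_mul_coefNr opprK.
Qed.

(** Composition with X + c is a ring morphism commuting with d/d eta. Equal orders make the Cauchy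
    sums range over the same indices. *)
Lemma formally_satisfies_lorenz_shift (c : K) x y z x' y' z' :
  (forall m, x' m = x m \Po ('X + c%:P)) ->
  (forall m, y' m = y m \Po ('X + c%:P)) ->
  (forall m, z' m = z m \Po ('X + c%:P)) ->
  ll_ord x' = ll_ord x -> ll_ord y' = ll_ord y -> ll_ord z' = ll_ord z ->
  formally_satisfies_lorenz x y z -> formally_satisfies_lorenz x' y' z'.
Proof.
move=> xE yE zE ox oy oz xyz m.
have mulE (f g f' g' : log_laurent K) :
    (forall m, f' m = f m \Po ('X + c%:P)) ->
    (forall m, g' m = g m \Po ('X + c%:P)) ->
    ll_ord f' = ll_ord f -> ll_ord g' = ll_ord g ->
    ll_mul_coef f' g' m = ll_mul_coef f g m \Po ('X + c%:P).
  move=> fE gE of_ og; rewrite /ll_mul_coef of_ og.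
  rewrite (big_morph _ (fun p q => comp_polyD p q _) (comp_poly0 _)).
  by apply: eq_bigr => k _; rewrite fE gE comp_polyM.
have [] := xyz m; rewrite /= => ex ey ez; split; rewrite /=.
- by rewrite xE yE xE dterm_shift ex comp_polyZ comp_polyB.
- rewrite !yE xE dterm_shift ey (mulE x z x' z') //.
  by rewrite !comp_polyB comp_polyZ.
- rewrite !zE dterm_shift ez (mulE x y x' y') //.
  by rewrite comp_polyD comp_polyZ.
Qed.

End Symmetries.

Lemma psi_satisfies_lorenz (K : numClosedFieldType) (C D : K) :
  formally_satisfies_lorenz (psi_x C D) (psi_y C D) (psi_z C D).
Proof.
apply: (@formally_satisfies_lorenz_shift _ C
  (LogLaurent (@psiP_lt K D)) (LogLaurent (@psiQ_lt K D))
  (LogLaurent (@psiR_lt K D))) => //.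
exact: (@psi_formal _ D).
Qed.

(** * Derivatives of polynomials in a function and of its integer powers *)

Section DerivePowers.
Variables (R : numFieldType) (V : normedModType R).
Implicit Types (f : V -> R) (x v : V).

Lemma is_derive_horner_comp f x v (df : R) (p : {poly R}) :
  is_derive x v f df -> is_derive x v (fun y => p.[f y]) (p^`().[f x] * df).
Proof.
move=> f'; elim/poly_ind: p => [|p c IHp].
  rewrite (_ : (fun y => _) = cst 0); last first.
    by apply/funext => y; rewrite horner0.
  by rewrite deriv0 horner0 mul0r; exact: is_derive_cst.
rewrite (_ : (fun y => _) = (fun y => p.[f y]) * f + cst c); last first.
  by apply/funext => y; rewrite !hornerE.
apply: is_derive_eq.
rewrite derivMXaddC !hornerE /= /GRing.scale /=; ring.
Qed.

Lemma is_derive_exprz f x v (df : R) (m : int) : f x != 0 ->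
  is_derive x v f df ->
  is_derive x v (fun y => f y ^ m) (m%:~R * f x ^ (m - 1) * df).
Proof.
move=> fx0 f'.
have pow n : is_derive x v (fun y => f y ^+ n) (n%:R * f x ^+ n.-1 * df).
  have := is_derive_horner_comp 'X^n f'; rewrite derivXn hornerMn hornerXn.
  rewrite -(mulr_natl (f x ^+ n.-1)).
  by under eq_fun do rewrite hornerXn.
case: m => n.
  (* At n = 0 the exponents -1 and 0 differ, but the factor n kills both sides. *)
  have -> : n%:Z%:~R * f x ^ (n%:Z - 1) = n%:R * f x ^+ n.-1.
    by case: n => [|n]; rewrite ?mul0r // subzSS subr0.
  exact: pow.
have pown := pow n.+1.
have fxn0 : f x ^+ n.+1 != 0 by rewrite expf_neq0.
apply: DeriveDef; first exact: derivableV.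
rewrite deriveV // derive_val /GRing.scale /=.
rewrite NegzE -opprD -exprnN.
have yn0 : f x ^+ n != 0 by rewrite expf_neq0.
rewrite addn1 !exprS mulrNz -[n.+1%:~R]/(n.+1%:R).
move: (n.+1%:R) (f x ^+ n) yn0 => a y y0; field.
by rewrite fx0 y0.
Qed.
End DerivePowers.

(** * The complex exponential near 0 and the derivative of its local inverses *)

Section ComplexExp.
Variable R : realType.
Local Notation C := (R[i]^o).
Implicit Types z w h k : C.

Lemma cexp0 : cexp (0 : C) = 1.
Proof. by rewrite /cexp /= expR0 cos0 sin0 mulr0 mulr1. Qed.

Lemma cexpD z w : cexp (z + w) = cexp z * cexp w.
Proof.
case: z w => [a b] [c d]; rewrite /cexp /= expRD cosD sinD.
by apply/eqP; rewrite eq_complex /=; apply/andP; split; apply/eqP; ring.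
Qed.

Lemma cexp_neq0 z : cexp z != 0.
Proof.
apply/eqP => e0; have := cexp0; rewrite -(subrr z) cexpD e0 mul0r => /eqP.
by rewrite eq_sym oner_eq0.
Qed.

(** Differentiability without quotients: the estimate also covers a = 0, so estimates in Re h and Im
    h can be combined. *)
Lemma is_derive0_littleo (f : R -> R) (l : R) : is_derive (0 : R) 1 f l ->
  forall e, 0 < e -> \forall a \near (0 : R), `|f a - f 0 - l * a| <= e * `|a|.
Proof.
move=> [df dl] e e0.
have : (fun a : R => a^-1 *: ((f (a *: (1 : R^o) + 0) : R^o) - f 0)) @ 0^' -->
    l.
  by rewrite -dl; exact: df.
move=> /cvgrPdist_le /(_ e e0); rewrite near_withinE; apply: filterS => a ha.
have [->|a0] := eqVneq a 0; first by rewrite subrr mulr0 subr0 normr0 mulr0.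
have := ha a0; rewrite addr0 /GRing.scale /= mulr1.
have -> : l - a^-1 * (f a - f 0) = - (a^-1 * (f a - f 0 - l * a)).
  by field.
by rewrite normrN normrM normfV ler_pdivrMl ?normr_gt0 // (mulrC e).
Qed.

Lemma ler_norm_Re_Im z : `|z| <= (`|complex.Re z| + `|complex.Im z|)%:C%C.
Proof.
case: z => a b; rewrite -[X in `|X|]/((a +i* b)%C).
have -> : (a +i* b = a%:C + Complex 0 b)%C.
  by apply/eqP; rewrite eq_complex /= addr0 add0r !eqxx.
apply: le_trans (ler_normD _ _) _.
by rewrite !normc_def /= expr0n /= !addr0 !add0r !sqrtr_sqr -rmorphD lexx.
Qed.

Lemma near_Re_Im (P Q : R -> Prop) :
  (\forall a \near (0 : R), P a) -> (\forall b \near (0 : R), Q b) ->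
  \forall h \near (0 : C), P (complex.Re h) /\ Q (complex.Im h).
Proof.
move=> /nbhs_ballP[d d0 dP] /nbhs_ballP[e e0 eQ].
pose m := Num.min d e; have m0 : 0 < m by rewrite lt_min [0 < d]d0 [0 < e]e0.
have m0C : 0 < (m%:C%C : C) by rewrite ltcR.
have near_h := @nbhsx_ballx _ C (0 : C) _ m0C.
rewrite -ball_normE in near_h.
apply: filterS near_h => -[a b] /=; rewrite sub0r normrN => lt_h.
have lt_a : `|a| < m.
  by rewrite -ltcR; apply: le_lt_trans lt_h; exact: (normc_ge_Re (a +i* b)%C).
have lt_b : `|b| < m.
  rewrite -ltcR; apply: le_lt_trans lt_h.
  rewrite normc_def lecR -sqrtr_sqr ler_wsqrtr // lerDr; exact: sqr_ge0.
split; [apply: dP|apply: eQ]; rewrite -ball_normE /= sub0r normrN.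
  by rewrite (lt_le_trans lt_a) // /m ge_min lexx.
by rewrite (lt_le_trans lt_b) // /m ge_min lexx orbT.
Qed.

(** For h = a + ib, both parts of the error split into products controlled by the real expansions of
    exp, cos and sin at 0. *)
Lemma cexp_littleo (e : R) : 0 < e ->
  \forall h \near (0 : C), `|cexp h - 1 - h| <= e%:C%C * `|h|.
Proof.
(* The four error terms below total at most (2 + 1 + 2 + 1) d |h| = 6 d |h|, so e / 8 suffices. *)
move=> e0; pose d := e / 8; have d0 : 0 < d by rewrite divr_gt0.
have expR1 := is_derive0_littleo (@is_derive_expR R 0) d0.
have cos1 := is_derive0_littleo (@is_derive_cos R 0) d0.
have sin1 := is_derive0_littleo (@is_derive_sin R 0) d0.
have expRc : {for (0 : R), continuous (@expR R)} by exact: continuous_expR.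
(* The bound d serves the cross term (1 - exp a) b; the bound 1 gives exp a <= 2. *)
have expR2 : \forall a \near (0 : R), `|expR 0 - expR a| <= Num.min d 1.
  by move/cvgrPdist_le : expRc; apply; rewrite lt_min d0 ltr01.
apply: filterS (near_Re_Im (filterI expR1 expR2) (filterI cos1 sin1)).
case=> a b /= [[Ea Ea'] [Cb Sb]].
move: Ea Ea' Cb Sb; rewrite expR0 cos0 sin0 oppr0 mul0r !(oppr0, addr0) !mul1r.
rewrite le_min => Ea /andP[Ea' Ea''] Cb Sb.
pose N := Num.sqrt (a ^+ 2 + b ^+ 2).
have aN : `|a| <= N by rewrite -sqrtr_sqr ler_wsqrtr // lerDl sqr_ge0.
have bN : `|b| <= N by rewrite -sqrtr_sqr ler_wsqrtr // lerDr sqr_ge0.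
have E2 : `|expR a| <= 2.
  rewrite -[expR a](subrK 1) (le_trans (ler_normD _ _)) // normr1 distrC.
  by lra.
apply: le_trans (ler_norm_Re_Im _) _.
rewrite [`|(a +i* b)%C|]normc_def -rmorphM lecR /= -/N.
have -> : expR a * cos b - 1 - a = expR a * (cos b - 1) + (expR a - 1 - a).
  by ring.
have -> : expR a * sin b - 0 - b = expR a * (sin b - b) - (1 - expR a) * b.
  by ring.
have Re_le := ler_normD (expR a * (cos b - 1)) (expR a - 1 - a).
have Im_le := ler_normB (expR a * (sin b - b)) ((1 - expR a) * b).
rewrite !normrM in Re_le Im_le.
have c1 : `|expR a| * `|cos b - 1| <= 2 * (d * N).
  by apply: ler_pM => //; apply: le_trans Cb _; rewrite ler_wpM2l // ltW.
have c2 : `|expR a| * `|sin b - b| <= 2 * (d * N).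
  by apply: ler_pM => //; apply: le_trans Sb _; rewrite ler_wpM2l // ltW.
have c3 : `|1 - expR a| * `|b| <= d * N by apply: ler_pM.
have c4 : `|expR a - 1 - a| <= d * N.
  by apply: le_trans Ea _; rewrite ler_wpM2l // ltW.
have -> : e * N = 8 * (d * N) by rewrite /d; field.
have : 0 <= d * N by rewrite mulr_ge0 ?sqrtr_ge0 // ltW.
lra.
Qed.

(** The value 1 at 0 makes this quotient continuous there, so it can be composed with any increment
    tending to 0. *)
Definition cexpm1_div k : C := if k == 0 then 1 else (cexp k - 1) / k.

Lemma cexpm1_div_cvg : cexpm1_div @ (0 : C) --> (1 : C).
Proof.
apply/(@cvgrPdist_le _ C _ _ (nbhs_filter (0 : C))) => -[e e'] /=.
rewrite ltcE /= => /andP[/eqP-> e0].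
apply: filterS (cexp_littleo e0) => k ke; rewrite /cexpm1_div.
case: eqVneq => [_|k0]; first by rewrite subrr normr0 lecR ltW.
rewrite -(ler_pM2r (_ : 0 < `|k|)) ?normr_gt0 //; apply: le_trans ke.
by rewrite -normrM mulrBl mul1r divfK // distrC addrAC.
Qed.

(* The increment k of a logarithm eta of b (s - t0) satisfies
   s - t = (t - t0) (cexp k - 1), whence (s - t)/k -> t - t0. *)
Lemma is_derive_cexp_inv (eta : C -> C) (b t0 t : C) : b != 0 ->
  {for t, continuous eta} ->
  (\forall s \near t, cexp (eta s) = b * (s - t0)) ->
  is_derive t 1 eta (t - t0)^-1.
Proof.
move=> b0 ceta etaE.
have et : cexp (eta t) = b * (t - t0) by exact: nbhs_singleton etaE.
have t0n : t - t0 != 0.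
  by apply/eqP => tt0; have := cexp_neq0 (eta t); rewrite et tt0 mulr0 eqxx.
have lim : (fun h : C => h^-1 *: (eta (h *: (1 : C) + t) - eta t)) @ 0^' -->
    ((t - t0)^-1 : C).
  pose k h := eta (h *: (1 : C) + t) - eta t.
  have near_t : (h *: (1 : C) + t) @[h --> (0 : C)^'] -->
      (0 *: (1 : C) + t : C).
    apply: cvg_within_filter; apply: cvgD; last exact: cvg_cst.
    by apply: cvgZr_tmp; exact: cvg_id.
  rewrite scale0r add0r in near_t.
  have k0 : k @ 0^' --> (eta t - eta t : C).
    by apply: cvgB; [exact: cvg_comp near_t ceta|exact: cvg_cst].
  rewrite subrr in k0.
  have near_eta : \forall h \near (0 : C)^',
      cexp (eta (h *: (1 : C) + t)) = b * (h *: (1 : C) + t - t0).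
    exact: near_t etaE.
  have lim : (fun h => (t - t0)^-1 * (cexpm1_div (k h))^-1) @ (0 : C)^' -->
      ((t - t0)^-1 * 1^-1 : C).
    apply: cvgM; first exact: cvg_cst.
    apply: cvgV; first exact: oner_neq0.
    exact: cvg_comp k0 cexpm1_div_cvg.
  rewrite invr1 mulr1 in lim.
  apply: cvg_trans lim; apply: near_eq_cvg.
  near=> h.
  have h0 : h != 0 by near: h; exact: nbhs_dnbhs_neq.
  have eh : cexp (eta (h *: (1 : C) + t)) = b * (h *: (1 : C) + t - t0).
    by near: h.
  have kE : h = (t - t0) * (cexp (k h) - 1).
    apply: (mulfI b0).
    have : cexp (eta (h *: (1 : C) + t)) = cexp (k h) * (b * (t - t0)).
      by rewrite -et -cexpD /k subrK.
    rewrite eh [h *: _]mulr1 => ek.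
    have -> : b * h = b * (h + t - t0) - b * (t - t0) by ring.
    by rewrite ek; ring.
  (* By [kE], h != 0 forces cexp (k h) != 1 and hence k h != 0, so [cexpm1_div] is a true quotient
     here. *)
  have c1 : cexp (k h) - 1 != 0.
    by apply: contra_neq h0 => c1; rewrite kE c1 mulr0.
  have kh0 : k h != 0.
    by apply: contra_neq c1 => ->; rewrite cexp0 subrr.
  rewrite /cexpm1_div (negPf kh0) -/(k h) [in RHS]/GRing.scale /=.
  rewrite [X in _ = X^-1 * _]kE; field.
  by rewrite c1 kh0 t0n.
apply: DeriveDef; first by apply/cvg_ex; exists (t - t0)^-1; exact: lim.
exact: cvg_lim lim.
Unshelve. all: by end_near.
Qed.

End ComplexExp.

(** * Branches of log (b (t - t0)) as admissible eta *)

Section LogBranch.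
Variable R : realType.
Local Notation C := (R[i]^o).

(** V is open, so exp eta = b (s - t0) holds near t and yields eta' = 1/(t - t0), free of b. The
    formal rule is then the product rule. *)
Lemma valid_eta_log_branch (b t0 : C) (V : set C) (log : C -> C) :
  b != 0 -> log_branch V log ->
  valid_eta [set t : C | V (b * (t - t0))] t0 (fun t : C => log (b * (t - t0))).
Proof.
move=> b0 [Vopen Vcont Vexp] t Ut.
have arg_cvg : {for t, continuous (fun s : C => b * (s - t0) : C)}.
  apply: (@continuousM _ C (cst b) (fun s : C => s - t0 : C)).
    exact: (@cst_continuous C C b t).
  apply: (@continuousB _ C C id (cst t0)); first exact: cvg_id.
  exact: (@cst_continuous C C t0 t).
have near_V : \forall s \near (t : C), V (b * (s - t0)).
  have nV : nbhs (b * (t - t0)) V by apply: open_nbhs_nbhs; split.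
  exact: arg_cvg nV.
have eta' : is_derive t (1 : C) (fun s : C => log (b * (s - t0)) : C)
    (t - t0)^-1.
  apply: (is_derive_cexp_inv b0); first exact: cvg_comp arg_cvg (Vcont _ Ut).
  by apply: filterS near_V => s; exact: Vexp.
(* The point t0 is outside the domain because exp never vanishes; negative powers of t - t0 are thus
   differentiable. *)
have t0n : t - t0 != 0.
  apply/eqP => tt0; have := cexp_neq0 (log (b * (t - t0))).
  by rewrite Vexp // tt0 mulr0 eqxx.
split=> // p m.
have dp := is_derive_horner_comp p eta'.
have dsub : is_derive t (1 : C) (fun s : C => s - t0 : C) (1 - 0).
  exact: is_deriveB.
have dpow := @is_derive_exprz _ C (fun s : C => s - t0) t 1 _ m t0n dsub.
apply: (is_derive_eq (is_deriveM dp dpow)).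
rewrite /dterm hornerD hornerZ mulrDl /GRing.scale /= subr0.
have -> : (t - t0) ^ m = (t - t0) * (t - t0) ^ (m - 1).
  by rewrite -{1}(subrK 1 m) expfzDr // expr1z mulrC.
field; exact: t0n.
Qed.

(** The term of order m + 1 differentiates to the term of order m of the formal derivative, which
    equals that of the right-hand side. *)
Lemma satisfies_lorenz_termwise_valid (U : set C) (t0 : C) (eta : C -> C)
    (x y z : log_laurent R[i]) :
  valid_eta U t0 eta -> formally_satisfies_lorenz x y z ->
  satisfies_lorenz_termwise U t0 eta x y z.
Proof.
move=> eta_ok xyz m t Ut; have [ex ey ez] := xyz m.
have term (f : log_laurent R[i]) :
    is_derive t (1 : C) (ll_term t0 eta f (m + 1))
    (ll_term t0 eta (ll_deriv f) m t).
  by have [_ /(_ (f (m + 1)) (m + 1))] := eta_ok t Ut; rewrite addrK.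
split.
- by have := term x; rewrite /ll_term ex.
- by have := term y; rewrite /ll_term ey.
- by have := term z; rewrite /ll_term ez.
Qed.

End LogBranch.

Theorem lemma3p2 (R : realType) (C D : R[i]) (t0 : R[i]^o) :
  let x := psi_x C D in
  let y := psi_y C D in
  let z := psi_z C D in
  [/\ formally_satisfies_lorenz x y z /\
      (forall m : int,
         [/\ x m = psiP D m \Po ('X + C%:P),
             y m = psiQ D m \Po ('X + C%:P) &
             z m = psiR D m \Po ('X + C%:P)]),
      formally_satisfies_lorenz (ll_opp x) (ll_opp y) z &
      forall b : R[i]^o, `|b| = 1 ->
      forall (V : set R[i]^o) (log : R[i]^o -> R[i]^o), log_branch V log ->
        let U := [set t : R[i]^o | V (b * (t - t0))] in
        let eta := fun t : R[i]^o => log (b * (t - t0)) in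
        [/\ valid_eta U t0 eta,
            satisfies_lorenz_termwise U t0 eta x y z &
            satisfies_lorenz_termwise U t0 eta (ll_opp x) (ll_opp y) z]].
Proof.
move=> x y z; have sat : formally_satisfies_lorenz x y z.
  exact: psi_satisfies_lorenz.
have satN := formally_satisfies_lorenzN sat.
split=> // b b1 V log log_V U eta.
have b0 : b != 0 by rewrite -normr_eq0 b1 oner_eq0.
have eta_ok : valid_eta U t0 eta by exact: valid_eta_log_branch.
by split=> //; exact: satisfies_lorenz_termwise_valid.
Qed.
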